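(* Let $f:\mathbb{R}^n\to\mathbb{R}$ be twice continuously differentiable with $\gamma$-Lipschitz continuous Hessian, and let $x_*$ be a minimizer of $f$. Let $\{x_t\}_{t\ge0}$ be generated by Algorithm INCR, and assume that \[ 0\preceq H_t,\qquad \|\nabla^2 f(x_t)-H_t\|\le\mu_t\qquad\forall t\ge0, \] where $0\le\mu_t\le\mu_u$ for some $\mu_u\ge0$. Moreover, assume that the cubic regularization parameter is chosen as \[ \eta_t=\gamma+\frac{2\mu_t}{\alpha_t\|x_*-x_t\|}\qquad\forall t\ge0 \] for some $\alpha_t\in(0,1]$. (a) If $f$ is strongly convex with parameter $\lambda>0$ and \[ \alpha_t=\min\left\{\frac13,\ \frac{\lambda}{6\mu_t},\ \sqrt{\frac{2\lambda}{\gamma\|x_t-x_*\|}}\right\}, \] then for any $t\ge0$, $f(x_{t+1})-f(x_* )\le(1-\alpha_t)\,(f(x_t)-f(x_* ))$. (b) If $f$ is only convex, and $\alpha_t$ is chosen such that $\alpha_0=1$ and $\alpha_t\in(0,1)$ for all $t\ge1$, then for any $t\ge0$, \[ f(x_{t+1})-f(x_* )\le A_t\left[\sum_{i=0}^t\frac{\mu_i\alpha_i^2\|x_i-x_*\|^2}{A_i}+\gamma\sum_{i=0}^t\frac{\alpha_i^3\|x_i-x_*\|^3}{3A_i}\right], \] where $A_0=1$ and $A_t=\prod_{i=1}^t(1-\alpha_i)$ for $t\ge1$.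
   Context: $\|\cdot\|$ is the Euclidean norm for vectors and the spectral norm for matrices; $\preceq$ is the Loewner order. The Hessian of $f$ is $\gamma$-Lipschitz if $\|\nabla^2 f(x)-\nabla^2 f(x')\|\le\gamma\|x-x'\|$ for all $x,x'$. The function $f$ is strongly convex with parameter $\lambda\ge0$ if $f(\alpha x+(1-\alpha)x')\le\alpha f(x)+(1-\alpha)f(x')-\frac{\alpha(1-\alpha)\lambda}{2}\|x-x'\|^2$ for all $x,x'\in\mathbb{R}^n$, $\alpha\in[0,1]$; ''only convex'' means $\lambda=0$. In a minimum, a term with zero denominator is read as $+\infty$. The formula for $\eta_t$ presupposes $x_t\ne x_*$ for the iterates considered. Algorithm INCR (inexact Newton method with cubic regularization): given $x_0\in\mathbb{R}^n$ and a nonnegative sequence $\{\eta_t\}_{t\ge0}$ (here chosen adaptively, $\eta_t$ may depend on $x_t$), for $t=0,1,2,\dots$ choose a symmetric matrix $H_t\in\mathbb{R}^{n\times n}$ (an approximation of $\nabla^2 f(x_t)$) and let \[ x_{t+1}=\arg\min_{x\in\mathbb{R}^n}\tilde f_{\eta_t}(x;x_t),\qquad \tilde f_{\eta_t}(x;x_t)=f(x_t)+\langle\nabla f(x_t),x-x_t\rangle+\tfrac12\langle H_t(x-x_t),x-x_t\rangle+\tfrac{\eta_t}{6}\|x-x_t\|^3 . \] *)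

(* Defs.v *)
From HB Require Import structures.
From mathcomp Require Import all_boot all_order all_algebra.
From mathcomp Require Import all_classical all_reals all_analysis.

Set Implicit Arguments.
Unset Strict Implicit.
Unset Printing Implicit Defensive.

Import Order.TTheory GRing.Theory Num.Theory.
Import numFieldNormedType.Exports.

Local Open Scope classical_set_scope.
Local Open Scope ring_scope.

Section Euclidean.
Context {R : realType} {n : nat}.
Implicit Types (u v : 'cV[R]_n) (A B : 'M[R]_n).

Definition dot u v : R := \sum_i u i 0 * v i 0.

(* The library's norm on 'cV[R]_n is the sup norm. It is used here only through
   the topology it induces (differentiability, continuity), on which all norms
   of R^n agree; every quantitative estimate uses [enorm] or [spectral_norm]. *)
Definition enorm u : R := Num.sqrt (dot u u).

(* Operator norm induced by [enorm]; the set is nonempty and bounded. *)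
Definition spectral_norm A : R :=
  sup [set enorm (A *m v) | v in [set v | enorm v <= 1]].

(* Loewner order; meant for symmetric A and B. *)
Definition loewner_le A B : Prop := forall v, 0 <= dot ((B - A) *m v) v.

End Euclidean.

Section Smooth.
Context {R : realType} {n : nat}.
Implicit Types (f : 'cV[R]_n -> R) (x y : 'cV[R]_n).

Definition partial (i : 'I_n) f x : R := 'D_(delta_mx i 0) f x.

Definition grad f x : 'cV[R]_n := \col_i partial i f x.

Definition hess f x : 'M[R]_n := \matrix_(i, j) partial j (partial i f) x.

Definition twice_continuously_differentiable f : Prop :=
  [/\ forall x, differentiable f x,
      forall x, differentiable (grad f) x &
      continuous (hess f)].

Definition hessian_lipschitz (gamma : R) f : Prop :=
  forall x y, spectral_norm (hess f x - hess f y) <= gamma * enorm (x - y).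

Definition strongly_convex (lambda : R) f : Prop :=
  forall x y (a : R), 0 <= a <= 1 ->
    f (a *: x + (1 - a) *: y)
      <= a * f x + (1 - a) * f y - a * (1 - a) * lambda / 2 * enorm (x - y) ^+ 2.

Definition minimizer f x : Prop := forall y, f x <= f y.

Definition cubic_model f (H : 'M[R]_n) (eta : R) (z x : 'cV[R]_n) : R :=
  f z + dot (grad f z) (x - z) + dot (H *m (x - z)) (x - z) / 2
    + eta / 6 * enorm (x - z) ^+ 3.

(* [x] is a run of the inexact Newton method with cubic regularization, for
   the Hessian approximations [H] and the regularization parameters [eta].
   The next iterate may be any global minimizer of the model, since the model
   can have several when [eta t = 0] and [H t] is singular. *)
Definition INCR f (H : nat -> 'M[R]_n) (eta : nat -> R) (x : nat -> 'cV[R]_n) :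
    Prop :=
  forall t, [/\ 0 <= eta t, (H t)^T = H t &
                minimizer (cubic_model f (H t) (eta t) (x t)) (x t.+1)].

(* In \bar R the inverse of 0 is +oo and [sqrte +oo = +oo]: for lambda > 0 a
   term whose denominator vanishes is therefore +oo. *)
Definition strongly_convex_rate (lambda gamma mu dist : R) : \bar R :=
  (mine (3^-1)%:E
     (mine (lambda%:E / (6 * mu)%:E)
           (sqrte ((2 * lambda)%:E / (gamma * dist)%:E))))%E.

(* The product starts at 1, so [Aprod alpha 0 = 1] whatever [alpha 0] is. *)
Definition Aprod (alpha : nat -> R) (t : nat) : R :=
  \prod_(1 <= i < t.+1) (1 - alpha i).

End Smooth.

(* Main.v *)
Require Import Defs.
From HB Require Import structures.
From mathcomp Require Import all_boot all_order all_algebra.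
From mathcomp Require Import all_classical all_reals all_analysis.
From mathcomp Require Import ring lra.
Import Order.TTheory GRing.Theory Num.Theory.
Import numFieldNormedType.Exports.
Local Open Scope ring_scope.

(** Consider one step from x to x' = x + s, put e = xstar - x, D = |e|, r = |s|,
    delta = f x - f xstar, delta' = f x' - f xstar, and write g, K, eta, mu,
    alpha for the gradient, the Hessian and the parameters at x.

    Part (b).  By the cubic Taylor bounds, f x' is at most the model value at
    x', hence at most the model value at x + alpha e, up to the terms
    mu r^2 / 2 - (eta - gamma) r^3 / 6.  The value of eta is such that these
    terms are at most mu (alpha D)^2 / 6 whatever r is.  Convexity of f on the
    segment from x to xstar then yields
      delta' <= (1 - alpha) delta + mu alpha^2 D^2 + gamma alpha^3 D^3 / 3
    (convex_descent), and the bound of the theorem unrolls this recursion.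

    Part (a).  Strong convexity improves the right-hand side by
    alpha (1 - alpha) lambda D^2 / 2 only, which absorbs the two error terms
    when gamma alpha^2 D <= lambda / 2, while the rate of the theorem only
    gives gamma alpha^2 D <= 2 lambda.  The missing factor 4 is gained by
    combining two lower bounds of f xstar, obtained from different points.

    - Comparison with y = x + b e, b = alpha (1/2 + alpha/4).  The model is
      replaced by the exact stationarity condition g + H s + (eta/2) r s = 0
      (cubic_model_stationary) together with the Taylor bound of f y.  The
      Hessian then enters only through the square of K at b e - s, which is
      bounded below by strong convexity (hess_ge).
    - Convexity of f at x', with the gradient at x' in place of the value at y.

    Each of them also bounds the part of f above the quadratic
    lambda |z - xstar|^2 / 2 by a slope times a distance, as if that part were
    linear up to xstar.  Its gradient vanishes at xstar and has a Lipschitz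
    derivative, so the slope has to be built up over some distance and
    something is gained there (gap_le_grad, gap_le_secant).

    The first bound involves the Taylor remainder of f at x', the second one
    that of the gradient.  Both come from the variation of the Hessian along
    the segment from x to x' and they cannot be extremal together; their
    combination is estimated as a whole (joint_remainder).

    Adding the first bound and alpha / 2 times the second one gives
      (1 + alpha/4) (delta' - (1 - alpha) delta) <= error,
    and after bounding the products of norms by weighted squares the error is
    - lambda alpha D^2 times the polynomial [margin] in alpha and the ratios
    gamma alpha^2 D / (2 lambda), mu alpha / lambda, r / (alpha D) and
    <e, s> / (alpha D^2).  This polynomial is affine in the first, second and
    fourth ratio, so its sign has to be checked only at the ends of their
    ranges, where it is a polynomial in two variables (margin_ge0). *)

(** * The Euclidean norm and the spectral norm *)

Section Euclid.
Context {R : realType} {n : nat}.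
Implicit Types (u v w : 'cV[R]_n) (A B : 'M[R]_n) (k : R).

Lemma dotC u v : dot u v = dot v u.
Proof. by apply: eq_bigr => i _; rewrite mulrC. Qed.

Lemma dotDl u v w : dot (u + v) w = dot u w + dot v w.
Proof.
by rewrite /dot -big_split /=; apply: eq_bigr => i _; rewrite mxE mulrDl.
Qed.

Lemma dotZl k u v : dot (k *: u) v = k * dot u v.
Proof. by rewrite /dot mulr_sumr; apply: eq_bigr => i _; rewrite mxE mulrA. Qed.

Lemma dotNl u v : dot (- u) v = - dot u v.
Proof. by rewrite -scaleN1r dotZl mulN1r. Qed.

Lemma dot0l v : dot 0 v = 0.
Proof. by rewrite -[0](scale0r 0) dotZl mul0r. Qed.

Lemma dotDr u v w : dot u (v + w) = dot u v + dot u w.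
Proof. by rewrite dotC dotDl !(dotC _ u). Qed.

Lemma dotZr k u v : dot u (k *: v) = k * dot u v.
Proof. by rewrite dotC dotZl dotC. Qed.

Lemma dotNr u v : dot u (- v) = - dot u v.
Proof. by rewrite dotC dotNl dotC. Qed.

Lemma dot0r v : dot v 0 = 0.
Proof. by rewrite dotC dot0l. Qed.

Definition dotE := (dotDl, dotDr, dotNl, dotNr, dotZl, dotZr, dot0l, dot0r).

Lemma mulmxDv A B v : (A + B) *m v = A *m v + B *m v.
Proof. exact: mulmxDl. Qed.

Lemma mulmxNv A v : (- A) *m v = - (A *m v).
Proof. exact: mulNmx. Qed.

Lemma mulmxvD A u v : A *m (u + v) = A *m u + A *m v.
Proof. exact: mulmxDr. Qed.

Lemma mulmxvN A v : A *m (- v) = - (A *m v).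
Proof. exact: mulmxN. Qed.

Lemma mulmxvZ A k v : A *m (k *: v) = k *: (A *m v).
Proof. by rewrite scalemxAr. Qed.

Definition bilinE := (mulmxDv, mulmxNv, mulmxvD, mulmxvN, mulmxvZ, dotE).

Lemma dot_ge0 u : 0 <= dot u u.
Proof. by apply: sumr_ge0 => i _; rewrite -expr2 sqr_ge0. Qed.

Lemma dot_eq0 u : (dot u u == 0) = (u == 0).
Proof.
apply/idP/eqP => [|->]; last by rewrite dot0l.
rewrite psumr_eq0 => [/allP u0|i _]; last by rewrite -expr2 sqr_ge0.
apply/colP => i; rewrite mxE; apply/eqP.
by have := u0 i; rewrite mem_index_enum => /(_ isT); rewrite -expr2 sqrf_eq0.
Qed.

Lemma enorm_ge0 u : 0 <= enorm u.
Proof. exact: sqrtr_ge0. Qed.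

Lemma enorm_sqr u : enorm u ^+ 2 = dot u u.
Proof. by rewrite sqr_sqrtr ?dot_ge0. Qed.

Lemma enorm_eq0 u : (enorm u == 0) = (u == 0).
Proof. by rewrite -dot_eq0 -enorm_sqr sqrf_eq0. Qed.

Lemma enorm_gt0 u : (0 < enorm u) = (u != 0).
Proof. by rewrite lt_neqAle eq_sym enorm_eq0 enorm_ge0 andbT. Qed.

Lemma enormZ k u : enorm (k *: u) = `|k| * enorm u.
Proof.
by rewrite /enorm !dotE mulrA -expr2 sqrtrM ?sqr_ge0// sqrtr_sqr.
Qed.

Lemma enormN u : enorm (- u) = enorm u.
Proof. by rewrite -scaleN1r enormZ normrN1 mul1r. Qed.

Lemma cauchy_schwarz u v : `|dot u v| <= enorm u * enorm v.
Proof.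
rewrite -[leRHS]ger0_norm ?mulr_ge0 ?enorm_ge0// -ler_sqr ?nnegrE//.
rewrite !real_normK ?num_real// exprMn !enorm_sqr.
have [->|v0] := eqVneq v 0; first by rewrite !dotE expr0n mulr0.
have vv : 0 < dot v v by rewrite lt_neqAle eq_sym dot_eq0 v0 dot_ge0.
rewrite -subr_ge0 -(pmulr_rge0 _ vv).
have -> : dot v v * (dot u u * dot v v - dot u v ^+ 2)
    = dot (dot v v *: u - dot u v *: v) (dot v v *: u - dot u v *: v).
  by rewrite !dotE (dotC v u); ring.
exact: dot_ge0.
Qed.

Lemma dot_le u v : dot u v <= enorm u * enorm v.
Proof. exact: le_trans (ler_norm _) (cauchy_schwarz u v). Qed.

Lemma enormD u v : enorm (u + v) <= enorm u + enorm v.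
Proof.
rewrite -ler_sqr ?nnegrE ?addr_ge0 ?enorm_ge0// enorm_sqr !dotE sqrrD !enorm_sqr.
by have := dot_le u v; rewrite (dotC v u); lra.
Qed.

Let opset A := [set enorm (A *m v) | v in [set v | enorm v <= 1]]%classic.

(** By the Cauchy-Schwarz inequality applied to each row, the Frobenius norm is
    an upper bound. *)
Lemma has_sup_opset A : has_sup (opset A).
Proof.
split; first by exists (enorm (A *m 0)); exists 0; rewrite //= /enorm dot0l sqrtr0.
pose c i := enorm (row i A)^T.
exists (Num.sqrt (\sum_i c i ^+ 2)) => _ [v /= v1 <-].
rewrite ler_sqrt ?sumr_ge0// => [|i _]; last exact: sqr_ge0.
apply: ler_sum => i _; rewrite -expr2.
have -> : (A *m v) i 0 = dot (row i A)^T v.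
  by rewrite mxE; apply: eq_bigr => j _; rewrite !mxE.
rewrite -real_normK ?num_real// ler_sqr ?nnegrE ?enorm_ge0//.
apply: le_trans (cauchy_schwarz _ _) _.
by rewrite ler_piMr ?enorm_ge0.
Qed.

Lemma enorm_mulmx A v : enorm (A *m v) <= spectral_norm A * enorm v.
Proof.
have [->|v0] := eqVneq v 0.
  by rewrite mulmx0 /enorm dot0l sqrtr0 mulr0.
have ev : 0 < enorm v by rewrite enorm_gt0.
have := ub_le_sup (has_sup_opset A).2 (ex_intro2 _ _ ((enorm v)^-1 *: v) _ erefl).
rewrite /= -scalemxAr !enormZ normfV (gtr0_norm ev) mulVf ?gt_eqF// lexx.
by move=> /(_ isT); rewrite mulrC ler_pdivrMr.
Qed.

Lemma spectral_norm_ge0 A : 0 <= spectral_norm A.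
Proof.
apply: le_trans (enorm_ge0 (A *m 0)) _.
apply: (ub_le_sup (has_sup_opset A).2).
by exists 0; rewrite //= /enorm dot0l sqrtr0.
Qed.

Lemma dot_mulmx_le A v w :
  `|dot (A *m v) w| <= spectral_norm A * enorm v * enorm w.
Proof.
apply: le_trans (cauchy_schwarz _ _) _.
by rewrite ler_wpM2r ?enorm_ge0 ?enorm_mulmx.
Qed.

End Euclid.

(** * Derivatives along lines *)

Section Calc.
Context {R : realType} {n : nat}.
Implicit Types (f : 'cV[R]_n -> R) (x s w : 'cV[R]_n).

Lemma derive_grad f x s : differentiable f x -> 'D_s f x = dot (grad f x) s.
Proof.
move=> fx; rewrite deriveE//.
have {1}-> : s = \sum_i s i 0 *: delta_mx i 0.
  rewrite {1}[s]matrix_sum_delta; apply: eq_bigr => i _.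
  by rewrite big_ord1.
rewrite linear_sum; apply: eq_bigr => i _.
by rewrite linearZ /= mxE /partial deriveE// mulrC.
Qed.

Lemma is_derive_line f x s (tau : R) : (forall z, differentiable f z) ->
  is_derive tau 1 (fun t : R => f (x + t *: s)) (dot (grad f (x + tau *: s)) s).
Proof.
move=> fd; rewrite -derive_grad//.
have E : (fun h : R => h^-1 *: (f (x + (h *: 1 + tau) *: s) - f (x + tau *: s)))
  = (fun h : R => h^-1 *: (f (h *: s + (x + tau *: s)) - f (x + tau *: s))).
  apply/funext => h; congr (_ *: (f _ - _)).
  by rewrite (_ : h *: 1 = h) ?scalerDl 1?addrCA//; exact: mulr1.
have dF : derivable (fun t : R => f (x + t *: s)) tau 1.
  have := diff_derivable (v := s) (fd (x + tau *: s)).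
  by rewrite /derivable -E.
have -> : 'D_s f (x + tau *: s) = 'D_1 (fun t : R => f (x + t *: s)) tau.
  by rewrite /derive -E.
exact: derivableP.
Qed.

Lemma differentiable_dot (g : 'cV[R]_n -> 'cV[R]_n) w x :
  differentiable g x -> differentiable (fun z => dot (g z) w) x.
Proof.
move=> gx.
rewrite (_ : (fun z => _) = \sum_i (fun z => g z i 0 * w i 0)); last first.
  by apply/funext => z; rewrite fct_sumE.
apply: differentiable_sum => i.
apply: differentiableM => //.
exact: (differentiable_comp gx (differentiable_coord _ _ _)).
Qed.

Lemma grad_dot_grad f w x : (forall z, differentiable (grad f) z) ->
  grad (fun z => dot (grad f z) w) x = (hess f x)^T *m w.
Proof.
move=> gd; apply/colP => j; rewrite !mxE /partial.
rewrite (_ : (fun z => _) = \sum_i (fun z => grad f z i 0 * w i 0)); last first.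
  by apply/funext => z; rewrite fct_sumE.
have gi i z : differentiable (fun z => grad f z i 0) z.
  exact: (differentiable_comp (gd z) (differentiable_coord _ _ _)).
rewrite derive_sum; last by move=> i; apply/diff_derivable/differentiableM.
apply: eq_bigr => i _; rewrite !mxE.
rewrite deriveM; [|exact/diff_derivable|exact/derivable_cst].
rewrite derive_cst scaler0 add0r; rewrite [LHS]/GRing.scale/= mulrC; congr (_ * _).
by rewrite /partial; congr ('D__ _ _); apply/funext => z; rewrite mxE.
Qed.

Lemma is_derive_grad_line f x s w (tau : R) :
  (forall z, differentiable (grad f) z) ->
  is_derive tau 1 (fun t : R => dot (grad f (x + t *: s)) w)
    (dot (hess f (x + tau *: s) *m s) w).
Proof.
move=> gd.
have -> : dot (hess f (x + tau *: s) *m s) w =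
    dot (grad (fun z => dot (grad f z) w) (x + tau *: s)) s.
  rewrite grad_dot_grad// /dot.
  transitivity (\sum_i \sum_j hess f (x + tau *: s) i j * s j 0 * w i 0).
    by apply: eq_bigr => i _; rewrite !mxE mulr_suml.
  rewrite exchange_big; apply: eq_bigr => j _; rewrite !mxE mulr_suml.
  by apply: eq_bigr => i _; rewrite !mxE; ring.
by apply: is_derive_line => z; exact: differentiable_dot.
Qed.

End Calc.

(** * Functions of one real variable *)

Section OneDim.
Context {R : realType}.
Implicit Types (h dh Theta Psi : R -> R) (p : {poly R}) (a b t u C L : R).

Definition deriv_polyE :=
  (@derivD R, @derivZ R, @derivX R, @derivXn R, @derivN R, @hornerMn R).

Lemma mean_value h dh a b : a <= b -> (forall t, is_derive t 1 h (dh t)) ->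
  exists2 t, a <= t <= b & h b - h a = dh t * (b - a).
Proof.
move=> ab hD; have [|t tab ->] := @MVT_segment _ h dh _ _ ab (fun t _ => hD t).
  apply: derivable_within_continuous => t _; exact: (@ex_derive _ _ _ _ _ _ _ (hD t)).
by exists t => //; move: tab; rewrite in_itv.
Qed.

Lemma derive_le_poly h dh p a b : a <= b ->
    (forall t, is_derive t 1 h (dh t)) ->
    (forall t, a <= t <= b -> dh t <= p^`().[t]) ->
  h b - h a <= p.[b] - p.[a].
Proof.
move=> ab hD dhp.
have pD t : is_derive t 1 (fun t => h t - p.[t]) (dh t - p^`().[t]).
  exact: (is_deriveB (hD t) (is_derive_poly p t)).
have [t tab] := mean_value _ _ _ _ ab pD.
have := dhp t tab; rewrite -subr_le0 => d0 E.
have : (dh t - p^`().[t]) * (b - a) <= 0 by rewrite mulr_le0_ge0 ?subr_ge0.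
by rewrite -E; lra.
Qed.

Lemma derive_ge_poly h dh p a b : a <= b ->
    (forall t, is_derive t 1 h (dh t)) ->
    (forall t, a <= t <= b -> p^`().[t] <= dh t) ->
  p.[b] - p.[a] <= h b - h a.
Proof.
move=> ab hD dhp.
have ND t : is_derive t 1 (fun t => - h t) (- dh t) by exact: (is_deriveN (hD t)).
have := derive_le_poly _ _ (- p) _ _ ab ND.
rewrite !hornerE => H; suff: - h b - - h a <= - p.[b] - - p.[a] by lra.
by apply: H => t /dhp; rewrite derivN hornerN lerN2.
Qed.

(** The function t |-> h t - t h' t / 2 has derivative (h' t - t h'' t) / 2, which
    the Taylor expansion of h' at t compares with h' 0 / 2. *)
Lemma trapezoid h h1 h2 L b : 0 <= b ->
    (forall t, is_derive t 1 h (h1 t)) -> (forall t, is_derive t 1 h1 (h2 t)) ->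
    (forall t, 0 <= t <= b -> h1 t - t * h2 t <= h1 0 + L / 2 * t ^+ 2) ->
  h b - h 0 <= b * (h1 0 + h1 b) / 2 + L / 12 * b ^+ 3.
Proof.
move=> b0 hD h1D H.
pose G t := h t - t * h1 t / 2.
pose p : {poly R} := (h1 0 / 2) *: 'X + (L / 12) *: 'X^3.
have tD t : is_derive t 1 (fun t : R => t * h1 t) (t * h2 t + h1 t).
  apply: is_derive_eq (is_deriveM (is_derive_id t 1) (h1D t)) _.
  by rewrite /GRing.scale /= mulr1.
have GD t : is_derive t 1 G ((h1 t - t * h2 t) / 2).
  have X := is_deriveB (hD t) (is_deriveZ 2^-1 (tD t)).
  have -> : G = h - 2^-1 *: (fun t => t * h1 t).
    by apply/funext => u; rewrite /G mulrC.
  apply: (is_derive_eq X).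
  suff : h1 t - 2^-1 * (t * h2 t + h1 t) = (h1 t - t * h2 t) / 2 by [].
  lra.
have Gp t : 0 <= t <= b -> (h1 t - t * h2 t) / 2 <= p^`().[t].
  by move=> /H; rewrite /p !deriv_polyE !hornerE /=; lra.
have := derive_le_poly _ _ _ _ _ b0 GD Gp.
by rewrite /G /p !hornerE /=; lra.
Qed.

(** A differential inequality Theta' >= - Psi' for a function Theta that need not
    be differentiable: bisecting an interval halves the total quadratic defect,
    which therefore vanishes in the limit. *)
Lemma secant_of_quadratic_defect Theta Psi C a b : a <= b ->
    (forall t u, a <= t -> t <= u -> u <= b ->
       Theta t - Theta u <= Psi u - Psi t + C * (u - t) ^+ 2) ->
  Theta a - Theta b <= Psi b - Psi a.
Proof.
move=> ab H.
have bisect k t u : a <= t -> t <= u -> u <= b ->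
    Theta t - Theta u <= Psi u - Psi t + C * (u - t) ^+ 2 / 2 ^+ k.
  elim: k t u => [|k IH] t u at_ tu ub.
    by rewrite expr0 divr1; exact: H.
  have e1 := IH t ((t + u) / 2) at_ ltac:(lra) ltac:(lra).
  have e2 := IH ((t + u) / 2) u ltac:(lra) ltac:(lra) ub.
  rewrite (exprS _ k) invfM; move: (2 ^+ k)^-1 e1 e2 => i.
  by move: (Theta _) (Theta _) (Theta _) (Psi _) (Psi _) (Psi _) => *; nra.
pose D := `|C| * (b - a) ^+ 2.
rewrite -subr_le0; set A := _ - _.
case: (leP A 0) => // A0.
have [N HN] : exists N, D / A < N%:R.
  exists (Num.bound (D / A)); apply: archi_boundP.
  apply: divr_ge0 (ltW A0); exact: mulr_ge0 (normr_ge0 C) (sqr_ge0 _).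
have := bisect N a b (lexx _) ab (lexx _).
have p0 : 0 < 2 ^+ N :> R by rewrite exprn_gt0.
have Np : N%:R <= 2 ^+ N :> R by rewrite -natrX ler_nat ltnW// ltn_expl.
have AD : D < A * 2 ^+ N.
  by rewrite mulrC -ltr_pdivrMr//; apply: lt_le_trans Np.
have CD : C * (b - a) ^+ 2 <= D by rewrite ler_wpM2r ?sqr_ge0 ?ler_norm.
have : C * (b - a) ^+ 2 / 2 ^+ N < A by rewrite ltr_pdivrMr//; lra.
by rewrite /A; lra.
Qed.

End OneDim.

Lemma le0_small {R : realType} (A C : R) :
  (forall h : R, 0 < h <= 1 -> A <= C * h) -> A <= 0.
Proof.
move=> H; case: (leP A 0) => // A0.
have C0 : 0 < C by have := H 1; rewrite ltr01 lexx => /(_ isT); lra.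
have AC : 0 < A + C by lra.
have q0 : 0 < A / (A + C) by rewrite divr_gt0.
have q1 : A / (A + C) <= 1 by rewrite ler_pdivrMr// mul1r; lra.
have qE : A / (A + C) * (A + C) = A by rewrite divfK ?lt0r_neq0.
have := H (A / (A + C) / 2); move: (A / (A + C)) qE q0 q1 => q qE q0 q1.
by move=> /(_ ltac:(lra)); nra.
Qed.

Ltac generalize_values f :=
  repeat match goal with |- context [f ?u] => generalize (f u); intro end.
Ltac generalize_dots :=
  repeat match goal with
  | |- context [dot ?u ?v] => generalize (dot u v); intro
  | |- context [enorm ?u] => generalize (enorm u); intro
  end.

(** * Taylor bounds for a function with Lipschitz Hessian *)

Section Taylor.
Context {R : realType} {n : nat}.
Variables (f : 'cV[R]_n -> R) (gam : R).
Hypothesis fD : forall z, differentiable f z.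
Hypothesis gD : forall z, differentiable (grad f) z.
Hypothesis lipH : hessian_lipschitz gam f.
Implicit Types (x y s w : 'cV[R]_n) (t : R).

Lemma hess_lip x s w t : 0 <= t ->
  dot (hess f (x + t *: s) *m s) w <=
    dot (hess f x *m s) w + gam * t * enorm s ^+ 2 * enorm w.
Proof.
move=> t0; rewrite -lerBlDl -dotNl -mulmxNv -dotDl -mulmxDv.
apply: le_trans (ler_norm _) _; apply: le_trans (dot_mulmx_le _ _ _) _.
have := lipH (x + t *: s) x; rewrite [in X in enorm X]addrC addKr enormZ ger0_norm// => H.
rewrite (_ : gam * t * enorm s ^+ 2 * enorm w
   = gam * (t * enorm s) * enorm s * enorm w); last by ring.
by rewrite !ler_wpM2r ?enorm_ge0.
Qed.

Lemma grad_taylor x s w :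
  dot (grad f (x + s)) w <=
    dot (grad f x) w + dot (hess f x *m s) w + gam / 2 * enorm s ^+ 2 * enorm w.
Proof.
pose c := gam / 2 * enorm s ^+ 2 * enorm w.
pose p : {poly R} := dot (hess f x *m s) w *: 'X + c *: 'X^2.
have dp t : 0 <= t <= 1 -> dot (hess f (x + t *: s) *m s) w <= p^`().[t].
  move=> /andP[t0 _]; rewrite /p !deriv_polyE !hornerE /=.
  by have := hess_lip x s w t t0; rewrite /c; generalize_dots; lra.
have := derive_le_poly _ _ _ _ _ ler01
  (fun t => is_derive_grad_line f x s w t gD) dp.
by rewrite scale1r scale0r addr0 /p !hornerE /= /c; generalize_dots; lra.
Qed.

Lemma taylor_le x s :
  f (x + s) <= f x + dot (grad f x) s + dot (hess f x *m s) s / 2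
    + gam / 6 * enorm s ^+ 3.
Proof.
pose c := gam / 6 * enorm s ^+ 3.
pose p : {poly R} := dot (grad f x) s *: 'X
  + (dot (hess f x *m s) s / 2) *: 'X^2 + c *: 'X^3.
have dp t : 0 <= t <= 1 -> dot (grad f (x + t *: s)) s <= p^`().[t].
  move=> /andP[t0 _]; rewrite /p !deriv_polyE !hornerE /=.
  have := grad_taylor x (t *: s) s.
  by rewrite mulmxvZ dotZl enormZ ger0_norm// /c; generalize_dots; lra.
have := derive_le_poly _ _ _ _ _ ler01 (fun t => is_derive_line f x s t fD) dp.
by rewrite scale1r scale0r addr0 /p !hornerE /= /c; generalize_dots; lra.
Qed.

Lemma taylor_ge x s :
  f x + dot (grad f x) s + dot (hess f x *m s) s / 2
    - gam / 6 * enorm s ^+ 3 <= f (x + s).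
Proof.
pose c := gam / 6 * enorm s ^+ 3.
pose p : {poly R} := dot (grad f x) s *: 'X
  + (dot (hess f x *m s) s / 2) *: 'X^2 - c *: 'X^3.
have dp t : 0 <= t <= 1 -> p^`().[t] <= dot (grad f (x + t *: s)) s.
  move=> /andP[t0 _]; rewrite /p !deriv_polyE !hornerE /=.
  have := grad_taylor x (t *: s) (- s).
  by rewrite mulmxvZ !dotNr dotZl enormN enormZ ger0_norm// /c; generalize_dots; lra.
have := derive_ge_poly _ _ _ _ _ ler01 (fun t => is_derive_line f x s t fD) dp.
by rewrite scale1r scale0r addr0 /p !hornerE /= /c; generalize_dots; lra.
Qed.

End Taylor.

(** * Symmetry of the Hessian, strong convexity and stationarity *)

Lemma cube_le {R : realFieldType} (r m : R) : 0 < r -> 0 <= m ->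
  m ^+ 3 <= r ^+ 3 + 3 / 2 * r * (m ^+ 2 - r ^+ 2) + (m ^+ 2 - r ^+ 2) ^+ 2 / r.
Proof.
move=> r0 m0; rewrite -subr_ge0 -(pmulr_rge0 _ r0).
have -> : r * (r ^+ 3 + 3 / 2 * r * (m ^+ 2 - r ^+ 2)
    + (m ^+ 2 - r ^+ 2) ^+ 2 / r - m ^+ 3)
  = (m - r) ^+ 2 * (m ^+ 2 + m * r + r ^+ 2 / 2) by field; exact: lt0r_neq0.
by rewrite mulr_ge0 ?sqr_ge0//; nra.
Qed.

(** The cube of the norm has derivative 3 |s| s at s, with a quadratic error. *)
Lemma enorm_cube_le {R : realType} {n : nat} (s v : 'cV[R]_n) :
  exists C, forall h : R, 0 < h <= 1 ->
    enorm (s + h *: v) ^+ 3 <=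
      enorm s ^+ 3 + 3 * h * enorm s * dot s v + C * h ^+ 2.
Proof.
have [->|s0] := eqVneq s 0.
  exists (enorm v ^+ 3) => h /andP[h0 h1].
  rewrite add0r dot0l enormZ (gtr0_norm h0) exprMn.
  have -> : enorm (0 : 'cV[R]_n) = 0 by apply/eqP; rewrite enorm_eq0.
  have v0 := exprn_ge0 3 (enorm_ge0 v).
  have := mulr_ge0 v0 (mulr_ge0 (sqr_ge0 h) (ltac:(lra) : 0 <= 1 - h)).
  by generalize_dots; lra.
have r0 : 0 < enorm s by rewrite enorm_gt0.
exists (3 / 2 * enorm s * dot v v + (2 * `|dot s v| + dot v v) ^+ 2 / enorm s).
move=> h /andP[h0 h1].
have := cube_le _ _ r0 (enorm_ge0 (s + h *: v)).
rewrite !enorm_sqr.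
have -> : dot (s + h *: v) (s + h *: v) - dot s s
    = h * (2 * dot s v + h * dot v v).
  by rewrite !dotE (dotC v s); generalize_dots; ring.
have K : (2 * dot s v + h * dot v v) ^+ 2 <= (2 * `|dot s v| + dot v v) ^+ 2.
  rewrite -[leLHS]real_normK ?num_real// ler_sqr ?nnegrE ?addr_ge0 ?mulr_ge0 ?dot_ge0//.
  apply: le_trans (ler_normD _ _) _; rewrite !normrM (gtr0_norm h0).
  rewrite ger0_norm// lerD2l (ger0_norm (dot_ge0 v)).
  by rewrite ler_piMl ?dot_ge0.
have := ler_wpM2l (sqr_ge0 h) (ler_wpM2r (ltW (_ : 0 < (enorm s)^-1)) K).
rewrite invr_gt0 => /(_ r0); move: (_^-1) (`|_|) => i d; generalize_dots; lra.
Qed.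

Section Second.
Context {R : realType} {n : nat}.
Variables (f : 'cV[R]_n -> R) (gam : R).
Hypothesis fD : forall z, differentiable f z.
Hypothesis gD : forall z, differentiable (grad f) z.
Hypothesis lipH : hessian_lipschitz gam f.
Hypothesis gam0 : 0 <= gam.
Implicit Types (x y s u v w : 'cV[R]_n) (h t lam : R).

(** A second difference of f in the directions u and v is symmetric in u and v
    and approximates the Hessian form, whence the symmetry of the Hessian. *)
Let second_diff x u v h : 0 < h <= 1 ->
  `|f (x + h *: u + h *: v) - f (x + h *: v) - (f (x + h *: u) - f x)
    - h ^+ 2 * dot (hess f x *m u) v|
  <= gam * (enorm u + enorm v) ^+ 2 * enorm v * h ^+ 3.
Proof.
move=> /andP[h0 h1].
have D t := is_deriveB (is_derive_line f (x + h *: u) v t fD) (is_derive_line f x v t fD).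
have [t /andP[t0 th] ->] : exists2 t, 0 <= t <= h &
    f (x + h *: u + h *: v) - f (x + h *: v) - (f (x + h *: u) - f x) =
    (dot (grad f (x + h *: u + t *: v)) v - dot (grad f (x + t *: v)) v) * h.
  have [t th] := mean_value _ _ _ _ (ltW h0) D.
  by rewrite !fctE scale0r !addr0 subr0; exists t.
have A1 := grad_taylor f gam gD lipH x (h *: u + t *: v) v.
have A2 := grad_taylor f gam gD lipH x (t *: v) v.
have A3 := grad_taylor f gam gD lipH x (h *: u + t *: v) (- v).
have A4 := grad_taylor f gam gD lipH x (t *: v) (- v).
have N1 : enorm (h *: u + t *: v) <= h * (enorm u + enorm v).
  apply: le_trans (enormD _ _) _.
  rewrite !enormZ (gtr0_norm h0) (ger0_norm t0) mulrDr lerD2l.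
  by rewrite ler_wpM2r ?enorm_ge0.
have N2 : enorm (t *: v) <= h * (enorm u + enorm v).
  rewrite enormZ (ger0_norm t0) mulrDr ler_wpDl ?mulr_ge0 ?enorm_ge0 ?(ltW h0)//.
  by rewrite ler_wpM2r ?enorm_ge0.
have xE : x + (h *: u + t *: v) = x + h *: u + t *: v by rewrite addrA.
move: A1 A2 A3 A4 N1 N2; rewrite xE !bilinE enormN.
have := enorm_ge0 (h *: u + t *: v); have := enorm_ge0 (t *: v).
have := enorm_ge0 v.
move: (enorm (h *: u + t *: v)) (enorm (t *: v)) (enorm u) (enorm v) => A B U V.
generalize_dots.
move=> V0 B0 A0 e1 e2 e3 e4 AH BH.
have A2 : A ^+ 2 <= (h * (U + V)) ^+ 2 by rewrite ler_sqr ?nnegrE// (le_trans A0).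
have B2 : B ^+ 2 <= (h * (U + V)) ^+ 2 by rewrite ler_sqr ?nnegrE// (le_trans B0).
have c0 : 0 <= gam * V by rewrite mulr_ge0.
have := ler_wpM2l c0 A2; have := ler_wpM2l c0 B2 => k1 k2.
match goal with |- is_true (`|?a * h - h ^+ 2 * ?k| <= _) =>
  have -> : a * h - h ^+ 2 * k = h * (a - h * k) by ring end.
rewrite normrM (gtr0_norm h0) [leRHS](_ : _ = h * (gam * V * (h * (U + V)) ^+ 2)); last by ring.
by rewrite ler_pM2l// ler_norml; apply/andP; split; lra.
Qed.

Lemma hess_sym x u v : dot (hess f x *m u) v = dot (hess f x *m v) u.
Proof.
suff H a b : dot (hess f x *m a) b - dot (hess f x *m b) a <= 0.
  by apply/eqP; rewrite eq_le -!(subr_le0 (dot _ _)) !H.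
pose c w := gam * (enorm a + enorm b) ^+ 2 * enorm w.
apply: (@le0_small _ _ (c a + c b)) => h h1; have [h0 _] := andP h1.
have := second_diff x a b h h1; have := second_diff x b a h h1.
have -> : x + h *: b + h *: a = x + h *: a + h *: b by rewrite addrAC.
have -> : enorm b + enorm a = enorm a + enorm b by rewrite addrC.
rewrite -/(c a) -/(c b) !ler_norml.
move: (c a) (c b) => ca cb; generalize_values f; generalize_dots => /andP[_ k1] /andP[k2 _].
rewrite -(ler_pM2l (exprn_gt0 2 h0)); lra.
Qed.

(** Strong convexity at the midpoint of x + h v and x - h v, for small h *)
Lemma hess_ge lam x v : strongly_convex lam f ->
  lam * dot v v <= dot (hess f x *m v) v.
Proof.
move=> cvx; rewrite -subr_le0.
apply: (@le0_small _ _ (gam / 3 * enorm v ^+ 3)) => h /andP[h0 _].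
have a01 : 0 <= (2^-1 : R) <= 1 by lra.
have := cvx (x + h *: v) (x - h *: v) 2^-1 a01.
have -> : 2^-1 *: (x + h *: v) + (1 - 2^-1) *: (x - h *: v) = x.
  rewrite (_ : 1 - 2^-1 = 2^-1 :> R); last by lra.
  rewrite -scalerDr addrACA subrr addr0 scalerDr -scalerDl.
  by rewrite (_ : 2^-1 + 2^-1 = 1 :> R) ?scale1r//; lra.
have -> : x + h *: v - (x - h *: v) = (2 * h) *: v.
  by rewrite opprB addrC addrA subrK -scalerDl -mulr2n mulr_natl.
have := taylor_le f gam fD gD lipH x (h *: v).
have := taylor_le f gam fD gD lipH x (- (h *: v)).
rewrite enormN !enormZ !bilinE (gtr0_norm h0) normrM (gtr0_norm h0) ger0_norm//.
rewrite !exprMn -enorm_sqr.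
generalize_values f; generalize_dots => k1 k2 k3.
rewrite -(ler_pM2l (exprn_gt0 2 h0)); lra.
Qed.

Lemma grad_minimizer z w : minimizer f z -> dot (grad f z) w = 0.
Proof.
move=> zmin; suff H v : - dot (grad f z) v <= 0.
  have := H w; have := H (- w); rewrite dotNr; generalize_dots; lra.
apply: (@le0_small _ _ (`|dot (hess f z *m v) v| / 2 + gam / 6 * enorm v ^+ 3)).
move=> h /andP[h0 h1].
have := taylor_le f gam fD gD lipH z (h *: v); have := zmin (z + h *: v).
rewrite enormZ !bilinE (gtr0_norm h0) exprMn.
have := ler_norm (dot (hess f z *m v) v).
have := mulr_ge0 gam0 (exprn_ge0 3 (enorm_ge0 v)).
move: (`|_|) => d; generalize_values f; generalize_dots => k1 k2 k3 k4.
rewrite -(ler_pM2l h0).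
have g3 := mulr_ge0 k1 (mulr_ge0 (sqr_ge0 h) (ltac:(lra) : 0 <= 1 - h)).
have := ler_wpM2l (sqr_ge0 h) k2; lra.
Qed.

(** The first-order optimality condition g + H s + (eta/2) |s| s = 0, tested
    against w *)
Lemma cubic_model_stationary (H : 'M[R]_n) eta z s w : H^T = H ->
    minimizer (cubic_model f H eta z) (z + s) -> 0 <= eta ->
  dot (grad f z) w + dot (H *m s) w + eta / 2 * enorm s * dot s w = 0.
Proof.
move=> Hsym smin eta0.
have HC u v : dot (H *m u) v = dot (H *m v) u.
  have mxE1 (a b : 'cV[R]_n) : dot a b = (a^T *m b) 0 0.
    by rewrite mxE; apply: eq_bigr => i _; rewrite mxE.
  rewrite dotC !mxE1 mulmxA; congr ((_ *m _) 0 0).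
  by rewrite -[in RHS]Hsym trmx_mul trmxK.
suff Hw v : - (dot (grad f z) v + dot (H *m s) v
    + eta / 2 * enorm s * dot s v) <= 0.
  by have := Hw w; have := Hw (- w); rewrite !bilinE; generalize_dots; lra.
have [C hC] := enorm_cube_le s v.
apply: (@le0_small _ _ (`|dot (H *m v) v| / 2 + eta / 6 * C)) => h h1.
have {hC} := ler_wpM2l (divr_ge0 eta0 (ltac:(lra) : 0 <= 6)) (hC h h1).
have [h0 _] := andP h1.
have := smin (z + (s + h *: v)).
have zE u : z + u - z = u by rewrite addrC addKr.
rewrite /cubic_model !zE !bilinE (HC v s).
have := ler_wpM2l (sqr_ge0 h) (ler_norm (dot (H *m v) v)).
move: (`|_|) => d; generalize_values f; generalize_dots => k1 k2 k3.
rewrite -(ler_pM2l h0); lra.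
Qed.

End Second.

(** * Gap to the minimal value *)

Section Bump.
Context {R : realType} {n : nat}.
Variables (f : 'cV[R]_n -> R) (gam lam : R) (o : 'cV[R]_n).
Hypothesis fD : forall z, differentiable f z.
Hypothesis gD : forall z, differentiable (grad f) z.
Hypothesis lipH : hessian_lipschitz gam f.
Hypothesis gam0 : 0 <= gam.
Hypothesis cvx : strongly_convex lam f.
Hypothesis omin : minimizer f o.
Implicit Types (d z s w : 'cV[R]_n) (t b om J : R).

(* The restriction of f to the line through o along d, minus the quadratic that
   strong convexity guarantees, and its first two derivatives *)
Let h d t := f (o + t *: d) - lam / 2 * enorm d ^+ 2 * t ^+ 2.
Let h1 d t := dot (grad f (o + t *: d)) d - lam * enorm d ^+ 2 * t.
Let h2 d t := dot (hess f (o + t *: d) *m d) d - lam * enorm d ^+ 2.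

Let hD d t : is_derive t 1 (h d) (h1 d t).
Proof.
have P := is_derive_poly ((lam / 2 * enorm d ^+ 2) *: 'X^2) t.
have D := is_deriveB (is_derive_line f o d t fD) P.
have -> : h d = (fun t => f (o + t *: d)) - horner ((lam / 2 * enorm d ^+ 2) *: 'X^2).
  by apply/funext => u; rewrite /h !fctE !hornerE.
apply: (is_derive_eq D); rewrite /h1 !deriv_polyE !hornerE /=; generalize_dots; lra.
Qed.

Let h1D d t : is_derive t 1 (h1 d) (h2 d t).
Proof.
have P := is_derive_poly ((lam * enorm d ^+ 2) *: 'X) t.
have D := is_deriveB (is_derive_grad_line f o d d t gD) P.
have -> : h1 d = (fun t => dot (grad f (o + t *: d)) d) - horner ((lam * enorm d ^+ 2) *: 'X).
  by apply/funext => u; rewrite /h1 !fctE !hornerE.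
by apply: (is_derive_eq D); rewrite /h2 !deriv_polyE !hornerE.
Qed.

Let h1_ndecr d t u : t <= u -> h1 d t <= h1 d u.
Proof.
move=> tu; have [v _ E] := mean_value _ _ _ _ tu (h1D d).
rewrite -subr_ge0 E mulr_ge0 ?subr_ge0// /h2 enorm_sqr.
exact: hess_ge.
Qed.

(** As h is convex with h' 0 = 0, bounding h 1 - h 0 by a slope J is wasteful near 0;
    the trapezoidal rule on [0, om] shows a gain of om J / 2, up to a
    cubic term. *)
Let bump d om J : 0 <= om -> h1 d om <= J -> h d 1 - h d om <= (1 - om) * J ->
  h d 1 - h d 0 <= (1 - om / 2) * J + gam / 12 * (om * enorm d) ^+ 3.
Proof.
move=> om0 hJ hJ1.
have T : forall t, 0 <= t <= om ->
    h1 d t - t * h2 d t <= h1 d 0 + gam * enorm d ^+ 3 / 2 * t ^+ 2.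
  move=> t /andP[t0 _]; rewrite /h1 /h2.
  have := grad_taylor f gam gD lipH (o + t *: d) (- (t *: d)) (- d).
  rewrite addrK scale0r addr0 !enormN enormZ (ger0_norm t0) !bilinE.
  by generalize_dots; lra.
have := trapezoid _ _ _ _ _ om0 (hD d) (h1D d) T.
have -> : h1 d 0 = 0.
  by rewrite /h1 scale0r addr0 (grad_minimizer f gam)//; lra.
have := ler_wpM2l om0 hJ; move: hJ1; rewrite exprMn.
move: (h1 d om) (h d 1) (h d 0) (h d om) (enorm d) => *; lra.
Qed.

Lemma gap_le_grad z om : 0 <= om <= 1 ->
  f z - f o - lam / 2 * enorm (z - o) ^+ 2 <=
    (1 - om / 2) * (dot (grad f z) (z - o) - lam * enorm (z - o) ^+ 2)
    + gam / 12 * (om * enorm (z - o)) ^+ 3.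
Proof.
move=> /andP[om0 om1]; set d := z - o.
have E : o + 1 *: d = z by rewrite scale1r addrC subrK.
have [u /andP[_ u1] hE] := mean_value _ _ _ _ om1 (hD d).
have := bump d om (h1 d 1) om0 (h1_ndecr d _ _ om1) _.
rewrite hE mulrC ler_wpM2l ?subr_ge0 ?h1_ndecr// => /(_ isT).
rewrite /h /h1 E scale0r addr0; generalize_values f; generalize_dots; lra.
Qed.

Lemma gap_le_secant z om b : 0 <= om -> 0 < b -> om + b <= 1 ->
  b * (f z - f o - lam / 2 * enorm (z - o) ^+ 2
       - gam / 12 * (om * enorm (z - o)) ^+ 3) <=
    (1 - om / 2) * (f z - f (z - b *: (z - o))
                    - lam / 2 * enorm (z - o) ^+ 2 * (2 * b - b ^+ 2)).
Proof.
move=> om0 b0 omb; set d := z - o.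
have E : o + 1 *: d = z by rewrite scale1r addrC subrK.
have Eb : o + (1 - b) *: d = z - b *: d.
  by rewrite scalerBl scale1r addrA (addrC o) subrK.
have [v /andP[v0 v1] hv] := mean_value _ _ _ _ (ltac:(lra) : 1 - b <= 1) (hD d).
have [u /andP[u0 u1] hu] := mean_value _ _ _ _ (ltac:(lra) : om <= 1 - b) (hD d).
have := bump d om (h1 d v) om0 (h1_ndecr d _ _ (ltac:(lra) : om <= v)) _.
have : h d 1 - h d om <= (1 - om) * h1 d v.
  have := ler_wpM2r (ltac:(lra) : 0 <= 1 - b - om) (h1_ndecr d _ _ (ltac:(lra) : u <= v)).
  move: hv hu.
  by move: (h d 1) (h d (1 - b)) (h d om) (h1 d v) (h1 d u) => *; nra.
move=> -> /(_ isT) /(ler_wpM2l (ltW b0)).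
have -> : b * ((1 - om / 2) * h1 d v + gam / 12 * (om * enorm d) ^+ 3) =
  (1 - om / 2) * (h d 1 - h d (1 - b)) + b * (gam / 12 * (om * enorm d) ^+ 3).
  by rewrite hv; move: (h1 d v) (enorm d) => *; ring.
by rewrite /h E Eb scale0r addr0; generalize_values f; generalize_dots; lra.
Qed.

End Bump.

(** * The remainders of the function and of its gradient *)

Section Remainder.
Context {R : realType} {n : nat}.
Variables (f : 'cV[R]_n -> R) (gam : R).
Hypothesis fD : forall z, differentiable f z.
Hypothesis gD : forall z, differentiable (grad f) z.
Hypothesis lipH : hessian_lipschitz gam f.
Hypothesis gam0 : 0 <= gam.
Variables (x s w : 'cV[R]_n).
Implicit Types t u : R.

Let z t := x + t *: s.
(* The sum of the remainder of f at x + s and of that of the gradient tested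
   against w, for the expansions at the intermediate point z t.  It vanishes at
   t = 1 and the lemma is about t = 0. *)
Let Theta t :=
  f (x + s) - f (z t) - (1 - t) * dot (grad f (z t)) s
  - (1 - t) ^+ 2 / 2 * dot (hess f (z t) *m s) s
  + dot (grad f (x + s)) w - dot (grad f (z t)) w
  - (1 - t) * dot (hess f (z t) *m s) w.

Let C := gam / 6 * enorm s ^+ 3 + gam / 2 * enorm s ^+ 2 * (enorm s + enorm w).

(** Moving the base point from z t to z u changes only the Hessian terms, up to
    second order: the increment of the Hessian, applied to s, is paired with
    (1 - u) (w + (1 - u) s / 2). *)
Let Theta_sub t u : 0 <= t -> t <= u -> u <= 1 ->
  Theta t - Theta u <=
    gam * enorm s ^+ 2 * (u - t) * ((1 - u) * enorm (w + ((1 - u) / 2) *: s))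
    + C * (u - t) ^+ 2.
Proof.
move=> t0 tu u1.
have zu : z u = z t + (u - t) *: s.
  by rewrite /z -addrA -scalerDl subrKC.
have d0 : 0 <= u - t by lra.
have d1 : u - t <= 1 by lra.
have c0 : 0 <= 1 - u by lra.
have c1 : 1 - u <= 1 by lra.
pose v := w + ((1 - u) / 2) *: s.
have n2 : enorm (w + (1 - u) *: s) <= enorm s + enorm w.
  apply: le_trans (enormD _ _) _; rewrite enormZ (ger0_norm c0).
  by rewrite addrC lerD2r ler_piMl ?enorm_ge0.
have m2 : gam / 2 * enorm ((u - t) *: s) ^+ 2 * enorm (w + (1 - u) *: s)
    <= gam / 2 * enorm s ^+ 2 * (enorm s + enorm w) * (u - t) ^+ 2.
  rewrite enormZ (ger0_norm d0) exprMn.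
  rewrite [leRHS](_ : _ = gam / 2 * ((u - t) ^+ 2 * enorm s ^+ 2) * (enorm s + enorm w)); last by ring.
  apply: ler_wpM2l n2; apply: mulr_ge0; first exact: divr_ge0.
  by rewrite mulr_ge0 ?sqr_ge0.
have m1 : gam / 6 * enorm ((u - t) *: s) ^+ 3 <= gam / 6 * enorm s ^+ 3 * (u - t) ^+ 2.
  rewrite enormZ (ger0_norm d0) exprMn.
  rewrite [leLHS](_ : _ = gam / 6 * enorm s ^+ 3 * (u - t) ^+ 2 * (u - t)); last by ring.
  apply: ler_piMr d1.
  apply: mulr_ge0 (sqr_ge0 _); apply: mulr_ge0 (exprn_ge0 3 (enorm_ge0 s)).
  exact: divr_ge0.
have e1 := taylor_le f gam fD gD lipH (z t) ((u - t) *: s).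
have e2 := grad_taylor f gam gD lipH (z t) ((u - t) *: s) (w + (1 - u) *: s).
have e3 := hess_lip f gam lipH (z t) s v (u - t) d0.
have e3' := ler_wpM2l c0 e3.
move: e1 e2 e3' m1 m2; rewrite -zu /Theta /C -/v.
move: (enorm v) (enorm (w + _)) (enorm (_ *: s)) => nv nw ns.
rewrite /v {v e3 n2}; generalize_values (grad f); generalize_values (hess f); generalize_values f.
by rewrite !bilinE; generalize_dots; lra.
Qed.

(* Primitives of u ((1 - 2 u) P + 2 u Q) and of u ((2 - 2 u) P + (2 u - 1) Q), the
   integrands obtained when a convex function of u is replaced by its chord with
   values P and Q over [0, 1/2] and over [1/2, 1] respectively *)
Let prim_low (P Q u : R) := P * (u ^+ 2 / 2 - 2 / 3 * u ^+ 3) + Q * (2 / 3 * u ^+ 3).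
Let prim_high (P Q u : R) := P * (u ^+ 2 - 2 / 3 * u ^+ 3) + Q * (2 / 3 * u ^+ 3 - u ^+ 2 / 2).

Let prim_low_sub (P Q u v : R) : 0 <= P -> 0 <= Q -> 0 <= u -> u <= v -> v <= 1 ->
  (v - u) * (u * ((1 - 2 * u) * P + 2 * u * Q)) <=
    prim_low P Q v - prim_low P Q u + (4 * P) * (v - u) ^+ 2.
Proof.
move=> P0 Q0 u0 uv v1; rewrite -subr_ge0 /prim_low.
set X := (X in 0 <= X).
have -> : X = (v - u) ^+ 2 * (P * (1 / 2 + 4 - 2 * u - 2 / 3 * (v - u))
   + Q * (2 * u + 2 / 3 * (v - u))) by rewrite /X; field.
apply: mulr_ge0 (sqr_ge0 _) _; apply: addr_ge0; apply: mulr_ge0 => //; lra.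
Qed.

Let prim_high_sub (P Q u v : R) : 0 <= P -> 0 <= Q -> 0 <= u -> u <= v -> v <= 1 ->
  (v - u) * (u * ((2 - 2 * u) * P + (2 * u - 1) * Q)) <=
    prim_high P Q v - prim_high P Q u + (4 * P + Q) * (v - u) ^+ 2.
Proof.
move=> P0 Q0 u0 uv v1; rewrite -subr_ge0 /prim_high.
set X := (X in 0 <= X).
have -> : X = (v - u) ^+ 2 * (P * (1 + 4 - 2 * u - 2 / 3 * (v - u))
   + Q * (2 * u + 2 / 3 * (v - u) + 1 / 2)) by rewrite /X; field.
apply: mulr_ge0 (sqr_ge0 _) _; apply: addr_ge0; apply: mulr_ge0 => //; lra.
Qed.

Let N0 := enorm w.
Let Nh := enorm (w + 4^-1 *: s).
Let N1 := enorm (w + 2^-1 *: s).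

Let norm_le_low u : 0 <= u <= 2^-1 ->
  enorm (w + (u / 2) *: s) <= (1 - 2 * u) * N0 + 2 * u * Nh.
Proof.
move=> /andP[u0 u1].
have -> : w + (u / 2) *: s = (1 - 2 * u) *: w + (2 * u) *: (w + 4^-1 *: s).
  rewrite scalerDr addrA -scalerDl scalerA subrK scale1r; congr (_ + _ *: _); lra.
apply: le_trans (enormD _ _) _; rewrite !enormZ !ger0_norm //; lra.
Qed.

Let norm_le_high u : 2^-1 <= u <= 1 ->
  enorm (w + (u / 2) *: s) <= (2 - 2 * u) * Nh + (2 * u - 1) * N1.
Proof.
move=> /andP[u0 u1].
have -> : w + (u / 2) *: s = (2 - 2 * u) *: (w + 4^-1 *: s)
    + (2 * u - 1) *: (w + 2^-1 *: s).
  rewrite !scalerDr addrACA -scalerDl !scalerA -scalerDl.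
  rewrite -[LHS]/(w + _) -{1}[w]scale1r; congr (_ *: _ + _ *: _); lra.
apply: le_trans (enormD _ _) _; rewrite !enormZ !ger0_norm //; lra.
Qed.

Let Gs := gam * enorm s ^+ 2.
Let Gs0 : 0 <= Gs. Proof. by rewrite mulr_ge0 ?sqr_ge0. Qed.

(** The integral of u |w + u s / 2| over [0, 1], where the convex factor is
    interpolated linearly at 0, 1/2 and 1.  Bounding the two remainders
    separately would replace the norms by sums of norms, although s and w
    partly compensate in the application. *)
Lemma joint_remainder :
  f (x + s) - f x - dot (grad f x) s - dot (hess f x *m s) s / 2
    + dot (grad f (x + s)) w - dot (grad f x) w - dot (hess f x *m s) w
  <= gam * enorm s ^+ 2 * (enorm w / 24 + enorm (w + 4^-1 *: s) / 4
       + 5 / 24 * enorm (w + 2^-1 *: s)).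
Proof.
have N00 : 0 <= N0 := enorm_ge0 _; have Nh0 : 0 <= Nh := enorm_ge0 _.
have N10 : 0 <= N1 := enorm_ge0 _.
have half0 : 0 <= 2^-1 :> R by lra.
have half1 : 2^-1 <= 1 :> R by lra.
have H1 t u : 0 <= t -> t <= u -> u <= 2^-1 ->
    Theta t - Theta u <= - (Gs * prim_high Nh N1 (1 - u)) - - (Gs * prim_high Nh N1 (1 - t))
      + (Gs * (4 * Nh + N1) + C) * (u - t) ^+ 2.
  move=> t0 tu u1.
  have b : 2^-1 <= 1 - u <= 1 by lra.
  have d0 : 0 <= u - t by lra.
  have c0 : 0 <= 1 - u by lra.
  have tu' : 1 - u <= 1 - t by lra.
  have t1 : 1 - t <= 1 by lra.
  have u1' : u <= 1 by lra.
  have m := ler_wpM2l Gs0 (ler_wpM2l d0 (ler_wpM2l c0 (norm_le_high _ b))).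
  have p := ler_wpM2l Gs0 (prim_high_sub Nh N1 (1 - u) (1 - t) Nh0 N10 c0 tu' t1).
  have T := Theta_sub t u t0 tu u1'.
  move: T m p; rewrite -/Gs.
  move: (prim_high Nh N1 (1 - u)) (prim_high Nh N1 (1 - t)) (Theta t) (Theta u) (enorm (w + _)) => a1 a2 a3 a4 a5.
  by move: Gs C Nh N1 => a6 a7 a8 a9; lra.
have H0 t u : 2^-1 <= t -> t <= u -> u <= 1 ->
    Theta t - Theta u <= - (Gs * prim_low N0 Nh (1 - u)) - - (Gs * prim_low N0 Nh (1 - t))
      + (Gs * (4 * N0) + C) * (u - t) ^+ 2.
  move=> t0 tu u1.
  have b : 0 <= 1 - u <= 2^-1 by lra.
  have d0 : 0 <= u - t by lra.
  have c0 : 0 <= 1 - u by lra.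
  have tu' : 1 - u <= 1 - t by lra.
  have t1 : 1 - t <= 1 by lra.
  have t0' : 0 <= t by lra.
  have m := ler_wpM2l Gs0 (ler_wpM2l d0 (ler_wpM2l c0 (norm_le_low _ b))).
  have p := ler_wpM2l Gs0 (prim_low_sub N0 Nh (1 - u) (1 - t) N00 Nh0 c0 tu' t1).
  have T := Theta_sub t u t0' tu u1.
  move: T m p; rewrite -/Gs.
  move: (prim_low N0 Nh (1 - u)) (prim_low N0 Nh (1 - t)) (Theta t) (Theta u) (enorm (w + _)) => a1 a2 a3 a4 a5.
  by move: Gs C Nh N0 => a6 a7 a8 a9; lra.
have e1 := secant_of_quadratic_defect _ _ _ _ _ half0 H1.
have e0 := secant_of_quadratic_defect _ _ _ _ _ half1 H0.
have T1 : Theta 1 = 0.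
  by rewrite /Theta /z scale1r !subrr expr0n !mul0r !subr0 add0r subrr.
have : Theta 0 <= Gs * (N0 / 24 + Nh / 4 + 5 / 24 * N1).
  move: e1 e0; rewrite T1 /prim_low /prim_high.
  by move: (Theta 0) (Theta 2^-1) N0 Nh N1 Gs => a0 a1 a2 a3 a4 a5; lra.
rewrite -/Gs -/N0 -/Nh -/N1; move: (_ * (N0 / 24 + _ + _)) => bound.
rewrite /Theta /z scale0r addr0 {H1 H0 e1 e0 T1}.
generalize_values f; generalize_dots.
lra.
Qed.

End Remainder.

(** * Positivity of the margin *)

(** Error of the combined estimate of the strongly convex case, with the opposite
    sign and in units of lambda a D^2, where
      G = gamma a^2 D / (2 lambda), nu = mu a / lambda, r = |s| / (a D)
    and t = <e, s> / (a D^2).  The weights 9/5, 5/3, 3 and 6 come from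
    mul_le_weighted_squares; like the constants of b and the factor 1 - a/4 they
    were selected to keep the minimum positive.  It is about 0.004, near
    a = 1/3, G = 1, nu = 1/6, r = t = 2/3. *)
Definition margin {R : realFieldType} (a G nu r t : R) : R :=
  let b := 1/2 + a/4 in
  let d2 := 1 - 2*a*t + a^+2 * r^+2 in
  (1/2 - a/4) * d2 / 2 - G * a / 96 * d2 * (1 + a*r)
  - (1 - a/4) * (G + nu) * r * (t - a * r^+2) / 2
  + (1 - a/4) * (b + a*r^+2/2 - a*b*t - (G + nu)*r*(b*t - r^+2) - G*b^+3/3)
  - b/2 - b*a*G/48
  - (1 - a/4) * (nu/2 * (9/5 * ((1+a/4)^+2 - 2*(1+a/4)*(1+a/2)*t + (1+a/2)^+2*r^+2) + 5/9*r^+2)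
    + G/2*r*((5/3*(d2/4) + 3/5*r^+2)/12
       + (3 * ((1 - 2*(a+1/2)*t + (a+1/2)^+2*r^+2)/4) + r^+2/3)/2
       + 5*(6 * ((1 - 2*(a+1)*t + (a+1)^+2*r^+2)/4) + r^+2/6)/12)).

Lemma affine_ge0 (R : realFieldType) (A B m M x : R) :
  m <= x <= M -> 0 <= A + B * m -> 0 <= A + B * M -> 0 <= A + B * x.
Proof. move=> /andP[mx xM]; case: (leP 0 B) => B0; nra. Qed.

Ltac bernstein_hints w0 r r0 m1 m2 k :=
  have := mulr_ge0 (w0 k) (mulr_ge0 r0 (sqr_ge0 (r - m1)));
  have := mulr_ge0 (w0 k) (mulr_ge0 r0 (sqr_ge0 (r - m2)));
  have := mulr_ge0 (w0 k) (sqr_ge0 (r - m1));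
  have := mulr_ge0 (w0 k) (sqr_ge0 (r - m2));
  have := mulr_ge0 (w0 k) r0;
  have := w0 k.

(** At a corner the margin is, in Bernstein form of degree 4 in a over [0, 1/3],
    a combination of five cubics in r with nonnegative weights.  Each cubic is in
    turn a nonnegative combination of r (r - m)^2, (r - m)^2, r and 1, where m is
    near its minimizer on the half-line; the two values m1 and m2 of m serve for
    all five cubics. *)
Ltac margin_corner m1 m2 :=
  let w0 := fresh "w0" in
  match goal with
  | a0 : is_true (0 <= ?a), a1 : is_true (?a <= 1 / 3), r0 : is_true (0 <= ?r) |- _ =>
    assert (w0 : forall k : nat, 0 <= a ^+ k * (1 / 3 - a) ^+ (4 - k));
    [move=> k; apply/mulr_ge0; apply/exprn_ge0; lra|];
    bernstein_hints w0 r r0 m1 m2 0%N; bernstein_hints w0 r r0 m1 m2 1%N;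
    bernstein_hints w0 r r0 m1 m2 2%N; bernstein_hints w0 r r0 m1 m2 3%N;
    bernstein_hints w0 r r0 m1 m2 4%N;
    rewrite /margin /=; lra
  end.

Section Corners.
Context {R : realFieldType}.
Variables (a r : R).
Hypothesis a_in : 0 <= a <= 1 / 3.
Hypothesis r0 : 0 <= r.

Let margin_00 : 0 <= margin a 0 0 r r /\ 0 <= margin a 0 0 r (- r).
Proof.
have [a0 a1] := andP a_in; have r_ge0 := r0; split.
  by margin_corner (1 : R) (1 : R).
by margin_corner (0 : R) (0 : R).
Qed.

Let margin_01 : 0 <= margin a 0 (1 / 6) r r /\ 0 <= margin a 0 (1 / 6) r (- r).
Proof.
have [a0 a1] := andP a_in; have r_ge0 := r0; split.
  by margin_corner (3/4 : R) (5/4 : R).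
by margin_corner (7/8 : R) (1/2 : R).
Qed.

Let margin_10 : 0 <= margin a 1 0 r r /\ 0 <= margin a 1 0 r (- r).
Proof.
have [a0 a1] := andP a_in; have r_ge0 := r0; split.
  by margin_corner (7/10 : R) (3/4 : R).
by margin_corner (1/2 : R) (1/4 : R).
Qed.

Let margin_11 : 0 <= margin a 1 (1 / 6) r r /\ 0 <= margin a 1 (1 / 6) r (- r).
Proof.
have [a0 a1] := andP a_in; have r_ge0 := r0; split.
  by margin_corner (2/3 : R) (3/4 : R).
by margin_corner (4/7 : R) (4/7 : R).
Qed.

Lemma margin_ge0 G nu t : 0 <= G <= 1 -> 0 <= nu <= 1 / 6 -> - r <= t <= r ->
  0 <= margin a G nu r t.
Proof.
move=> G1 nu1 tr.
have in_t G' nu' : 0 <= margin a G' nu' r r /\ 0 <= margin a G' nu' r (- r) ->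
    0 <= margin a G' nu' r t.
  pose B := margin a G' nu' r 1 - margin a G' nu' r 0.
  have E u : margin a G' nu' r u = margin a G' nu' r 0 + B * u.
    by rewrite /B /margin; field.
  rewrite (E r) (E (- r)) (E t) => -[h1 h2].
  exact: (affine_ge0 _ _ _ _ _ _ tr).
have in_nu G' : 0 <= margin a G' 0 r t -> 0 <= margin a G' (1 / 6) r t ->
    0 <= margin a G' nu r t.
  pose B := 6 * (margin a G' (1 / 6) r t - margin a G' 0 r t).
  have E u : margin a G' u r t = margin a G' 0 r t + B * u.
    by rewrite /B /margin; field.
  rewrite (E nu) (E (1 / 6)) => h1 h2; apply: (affine_ge0 _ _ _ _ _ _ nu1) => //.
  by rewrite mulr0 addr0.
pose B := margin a 1 nu r t - margin a 0 nu r t.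
have E u : margin a u nu r t = margin a 0 nu r t + B * u by rewrite /B /margin; field.
rewrite E; apply: (affine_ge0 _ _ _ _ _ _ G1); rewrite -E; apply: in_nu; exact: in_t.
Qed.

End Corners.

Lemma mul_le_weighted_squares {R : realFieldType} (k r m : R) : 0 < k ->
  r * m <= (k * m ^+ 2 + r ^+ 2 / k) / 2.
Proof.
move=> k0; rewrite -subr_ge0.
have -> : (k * m ^+ 2 + r ^+ 2 / k) / 2 - r * m = (k * m - r) ^+ 2 / k / 2.
  by field; exact: lt0r_neq0.
by rewrite !divr_ge0 ?sqr_ge0 ?ltW.
Qed.

(** The error of the combined estimate, with every norm expanded in terms of
    |e| = D, |s| = r and <e, s> = tau.  Here l2 is the square of the distance
    from x' to the minimizer and q y z that of y e + z s. *)
Lemma combined_error_le0 {R : realFieldType} (a D lam gam mu r tau : R) :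
  0 < a <= 1/3 -> 0 < D -> 0 < lam -> 0 <= gam -> 0 <= mu -> 0 <= r ->
  - (r * D) <= tau <= r * D -> 6 * mu * a <= lam -> gam * a ^+ 2 * D <= 2 * lam ->
  let b := a * (1/2 + a/4) in let W := 1 - a/4 in
  let q x y := x^+2 * D^+2 + 2 * x * y * tau + y^+2 * r^+2 in
  let l2 := q (-1) 1 in
  let eta := gam + 2 * mu / (a * D) in
  a / 2 * (lam / 2 * l2 - W * lam * l2 + gam / 96 * a ^+ 3 * l2 * (D + r))
  + W * (mu * ((9/5 * q (a * (1 + a/4)) (- (1 + a/2)) + r ^+ 2 / (9/5)) / 2)
     - lam / 2 * q b (-1) + eta / 2 * r * ((b + a/2) * tau - (1 + a/2) * r ^+ 2)
     + gam / 6 * b ^+ 3 * D ^+ 3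
     + gam * r * ((5/3 * q (- (a/2)) (a/2) + r ^+ 2 / (5/3)) / 2 / 24
                 + (3 * q (- (a/2)) (a/2 + 1/4) + r ^+ 2 / 3) / 2 / 4
                 + 5/24 * ((6 * q (- (a/2)) (a/2 + 1/2) + r ^+ 2 / 6) / 2))
     - lam / 2 * D ^+ 2 * (2 * b - b ^+ 2))
  + b * (lam / 2 * D ^+ 2 + gam / 96 * a ^+ 3 * D ^+ 3) <= 0.
Proof.
move=> /andP[a0 a1] D0 lam0 gam0 mu0 r0 /andP[t0 t1] mua gama /=.
set LHS := (X in X <= 0).
pose rho := r / (a * D); pose t := tau / (a * D ^+ 2).
pose G := gam * a ^+ 2 * D / (2 * lam); pose nu := mu * a / lam.
have aD : 0 < a * D by rewrite mulr_gt0.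
have lam2 : 0 < 2 * lam by lra.
have D2 : 0 < a * D ^+ 2 by rewrite mulr_gt0 ?exprn_gt0.
have -> : LHS = - (lam * a * D ^+ 2) * margin a G nu rho t.
  rewrite /LHS /margin /rho /t /G /nu; field.
  by rewrite !lt0r_neq0.
rewrite mulNr oppr_le0; apply: mulr_ge0.
  by rewrite -mulrA ltW// mulr_gt0.
apply: margin_ge0.
- by rewrite a1 ltW.
- by rewrite /rho divr_ge0// ltW.
- apply/andP; split; last by rewrite ler_pdivrMr// mul1r.
  exact: divr_ge0 (mulr_ge0 (mulr_ge0 gam0 (sqr_ge0 a)) (ltW D0)) (ltW lam2).
- apply/andP; split; last by rewrite ler_pdivrMr//; lra.
  exact: divr_ge0 (mulr_ge0 mu0 (ltW a0)) (ltW lam0).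
- have rhoE : rho = r * D / (a * D ^+ 2) by rewrite /rho; field; rewrite !lt0r_neq0.
  by rewrite rhoE /t -mulNr !ler_pM2r ?invr_gt0// t0.
Qed.

(** * One step of the method *)

Section Step.
Context {R : realType} {n : nat}.
Variables (f : 'cV[R]_n -> R) (gam : R) (x s e : 'cV[R]_n) (H : 'M[R]_n).
Variables (eta mu a : R).
Hypothesis fD : forall z, differentiable f z.
Hypothesis gD : forall z, differentiable (grad f) z.
Hypothesis lipH : hessian_lipschitz gam f.
Hypothesis gam0 : 0 <= gam.
Hypothesis omin : minimizer f (x + e).
Hypothesis e_neq0 : e != 0.
Hypothesis Hsym : H^T = H.
Hypothesis Happrox : spectral_norm (hess f x - H) <= mu.
Hypothesis mu0 : 0 <= mu.
Hypothesis a0 : 0 < a.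
Hypothesis etaE : eta = gam + 2 * mu / (a * enorm e).
Hypothesis smin : minimizer (cubic_model f H eta x) (x + s).

Let D0 : 0 < enorm e.
Proof. by rewrite enorm_gt0. Qed.

Let eta0 : 0 <= eta.
Proof.
by rewrite etaE addr_ge0// divr_ge0 ?mulr_ge0// ltW.
Qed.

Let approx_le v w :
  dot (H *m v) w - dot (hess f x *m v) w <= mu * enorm v * enorm w.
Proof.
rewrite -dotNl -dotDl -mulmxNv -mulmxDv -opprB mulmxNv dotNl.
apply: le_trans (ler_norm _) _; rewrite normrN.
apply: le_trans (dot_mulmx_le _ _ _) _.
by rewrite !ler_wpM2r ?enorm_ge0.
Qed.

(** The Hessian at x enters through the Taylor expansions at x' = x + s, of f and
    of its gradient, through that of f at x + b e, and through the stationarity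
    condition once it replaces H.  Altogether these terms are - W / 2 times the
    Hessian form at b e - s, which strong convexity bounds. *)
Lemma strongly_convex_descent lam : 0 < lam -> strongly_convex lam f ->
  a <= 1 / 3 -> 6 * mu * a <= lam -> gam * a ^+ 2 * enorm e <= 2 * lam ->
  f (x + s) - f (x + e) <= (1 - a) * (f x - f (x + e)).
Proof.
move=> lam0 cvx a1 mua gama.
(* The first bound has weight 1 and the second one a / 2.  The total weights
   a / 2 + b of f x - f (x + e) and a / 2 + W of f x - f (x + s) are in the
   ratio a : 1, as the conclusion demands. *)
pose b := a * (1 / 2 + a / 4); pose W := 1 - a / 4.
have W0 : 0 <= W by rewrite /W; lra.
have b0 : 0 < b by rewrite /b; apply: mulr_gt0 => //; have := a0; lra.
have omb : a / 2 + b <= 1 by rewrite /b; have := a0; nra.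
have om1 : 0 <= a / 2 <= 1 by have := a0; lra.
have r0 := enorm_ge0 s.
have tau0 := cauchy_schwarz e s; rewrite ler_norml in tau0.
have := combined_error_le0 a (enorm e) lam gam mu (enorm s) (dot e s).
rewrite a0 a1 D0 lam0 gam0 mu0 r0 mulrC tau0 mua gama.
move=> /(_ isT isT isT isT isT isT isT isT isT) /= main.
have qE y z : enorm (y *: e + z *: s) ^+ 2 =
    y ^+ 2 * enorm e ^+ 2 + 2 * y * z * dot e s + z ^+ 2 * enorm s ^+ 2.
  by rewrite !enorm_sqr !bilinE (dotC s e); generalize_dots; ring.
have ineqB := gap_le_secant f gam lam (x + e) fD gD lipH gam0 cvx omin x (a / 2) b
  (proj1 (andP om1)) b0 omb.
have ineqA := gap_le_grad f gam lam (x + e) fD gD lipH gam0 cvx omin (x + s) (a / 2) om1.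
have ineqQ := ler_wpM2l W0 (taylor_ge f gam fD gD lipH x (b *: e)).
have ineqT := ler_wpM2l W0 (joint_remainder f gam fD gD lipH gam0 x s ((a / 2) *: (s - e))).
have ineqK := ler_wpM2l W0 (hess_ge f gam fD gD lipH lam x (b *: e - s) cvx).
have ineqE := ler_wpM2l W0 (approx_le s ((a * (1 + a / 4)) *: e - (1 + a / 2) *: s)).
have Ste := cubic_model_stationary f H eta x s e Hsym smin eta0.
have Sts := cubic_model_stationary f H eta x s s Hsym smin eta0.
have zo : x - (x + e) = - e by rewrite opprD addrA addrN add0r.
have zso : x + s - (x + e) = s - e by rewrite opprD addrACA addrN add0r.
have zb : x - b *: - e = x + b *: e by rewrite scalerN opprK.
rewrite zo zb enormN in ineqB; rewrite zso in ineqA.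
rewrite -etaE -/b -/W in main.
have Ksym := hess_sym f gam fD gD lipH gam0 x e s.
(* The errors of H and of the Taylor expansions are bounded by products of
   norms; weighted squares make polynomials in |e|, |s| and <e, s> of them. *)
have nE : enorm s * enorm ((a * (1 + a / 4)) *: e - (1 + a / 2) *: s) <=
    (9/5 * (enorm ((a * (1 + a / 4)) *: e + (- (1 + a / 2)) *: s)) ^+ 2
     + enorm s ^+ 2 / (9/5)) / 2.
  by rewrite -scaleNr; apply: mul_le_weighted_squares; lra.
have nT k c : 0 < k -> enorm s * enorm ((a / 2) *: (s - e) + c *: s) <=
    (k * (enorm ((- (a / 2)) *: e + (a / 2 + c) *: s)) ^+ 2
     + enorm s ^+ 2 / k) / 2.
  move=> k0; rewrite (_ : (a / 2) *: (s - e) + c *: s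
    = (- (a / 2)) *: e + (a / 2 + c) *: s); first exact: mul_le_weighted_squares.
  by rewrite scalerBr scalerDl scaleNr addrAC addrC.
have n0 := nT (5/3) 0 ltac:(lra).
have n1 := nT 3 4^-1 ltac:(lra).
have n2 := nT 6 2^-1 ltac:(lra).
rewrite scale0r !addr0 qE in n0; rewrite qE in n1; rewrite qE in n2; rewrite qE in nE.
have l2E : enorm (s - e) ^+ 2 = (-1) ^+ 2 * enorm e ^+ 2
    + 2 * (-1) * 1 * dot e s + 1 ^+ 2 * enorm s ^+ 2.
  by rewrite -qE scaleN1r scale1r addrC.
have l3 : enorm (s - e) ^+ 3 <= enorm (s - e) ^+ 2 * (enorm e + enorm s).
  rewrite [leLHS]exprSr; apply: ler_wpM2l; first exact: sqr_ge0.
  by rewrite addrC -(enormN e) enormD.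
have bsE : dot (b *: e - s) (b *: e - s) =
    b ^+ 2 * enorm e ^+ 2 + 2 * b * (-1) * dot e s + (-1) ^+ 2 * enorm s ^+ 2.
  by rewrite -qE scaleN1r enorm_sqr.
rewrite bsE in ineqK; rewrite exprMn l2E in ineqA; rewrite l2E in l3.
have c2 : 0 <= a / 2 := proj1 (andP om1).
have cG : 0 <= W * (gam * enorm s) by rewrite !mulr_ge0.
have c3 : 0 <= gam * (a / 2) ^+ 4 / 12.
  by rewrite divr_ge0// mulr_ge0// exprn_ge0.
have cM : 0 <= W * mu by rewrite mulr_ge0.
have a4 : 0 < 1 + a / 4 by have := a0; lra.
rewrite -subr_le0 -(pmulr_rle0 _ a4).
(* The conclusion is a linear combination of these inequalities and equations;
   the multipliers of the stationarity condition tested against e and s cancel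
   the gradient at x. *)
move: {bsE l2E nT qE}
  main (ler_wpM2l c2 ineqA) ineqB ineqQ ineqT ineqK ineqE
  (congr1 ( *%R (W * (b + a / 2))) Ste) (congr1 ( *%R (W * (1 + a / 2))) Sts)
  (congr1 ( *%R (W * b)) Ksym) (ler_wpM2l cM nE) (ler_wpM2l cG n0) (ler_wpM2l cG n1) (ler_wpM2l cG n2)
  (ler_wpM2l c3 l3).
rewrite [enorm (b *: e)]enormZ (gtr0_norm b0).
move: (enorm (s - e)) (enorm (_ *: (s - e) + _)) (enorm (_ *: (s - e) + _)).
move: (enorm (_ *: (s - e))) (enorm (_ *: e - _)) => N1 N2 N3 N4 N5.
generalize_values (grad f); generalize_values (hess f); generalize_values f.
rewrite !bilinE (dotC s e) -!(enorm_sqr s).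
generalize_dots; rewrite /W /b; lra.
Qed.

Lemma convex_descent : strongly_convex 0 f -> a <= 1 ->
  f (x + s) - f (x + e) <= (1 - a) * (f x - f (x + e))
    + (mu * a ^+ 2 * enorm e ^+ 2 + gam * (a ^+ 3 * enorm e ^+ 3 / 3)).
Proof.
move=> cvx a1.
have aI : 0 <= a <= 1 by rewrite a1 ltW.
have aD : 0 < a * enorm e by rewrite mulr_gt0.
have := cvx (x + e) x a aI.
have -> : a *: (x + e) + (1 - a) *: x = x + a *: e.
  by rewrite scalerDr scalerBl scale1r addrAC subrKC.
have xE u : x + u - x = u by rewrite addrC addKr.
have m := smin (x + a *: e); rewrite /cubic_model !xE in m.
have t1 := taylor_le f gam fD gD lipH x s.
have t2 := taylor_ge f gam fD gD lipH x (a *: e).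
have h1 := approx_le s (- s); have h2 := approx_le (a *: e) (a *: e).
(* The left-hand side is maximal when |s| = a |e|. *)
have q : mu * (enorm s ^+ 2 / 2 - enorm s ^+ 3 / (3 * (a * enorm e)))
    <= mu * ((a * enorm e) ^+ 2 / 6).
  apply: ler_wpM2l => //; rewrite -subr_ge0.
  have -> : (a * enorm e) ^+ 2 / 6
      - (enorm s ^+ 2 / 2 - enorm s ^+ 3 / (3 * (a * enorm e)))
    = (enorm s - a * enorm e) ^+ 2 * (2 * enorm s + a * enorm e)
      / (6 * (a * enorm e)) by field; rewrite !lt0r_neq0.
  apply: divr_ge0; last by rewrite mulr_ge0 ?(ltW aD).
  apply: mulr_ge0; first exact: sqr_ge0.
  by rewrite addr_ge0 ?(ltW aD)// mulr_ge0 ?enorm_ge0.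
have k1 : eta * enorm s ^+ 3 = gam * enorm s ^+ 3
    + 6 * mu * (enorm s ^+ 3 / (3 * (a * enorm e))).
  by rewrite etaE; field; rewrite !lt0r_neq0.
have k2 : eta * (a * enorm e) ^+ 3 = gam * (a * enorm e) ^+ 3
    + 2 * mu * (a * enorm e) ^+ 2.
  by rewrite etaE; field; rewrite !lt0r_neq0.
move: m t1 t2 h1 h2 q k1 k2.
rewrite !enormZ enormN (gtr0_norm a0).
move: (enorm s ^+ 3 / _) => z.
generalize_values (grad f); generalize_values (hess f); generalize_values f.
rewrite !bilinE; generalize_dots; lra.
Qed.

End Step.

(** * The rate of the strongly convex case *)

Lemma rate_bounds {R : realType} (lam gam mu dist a : R) :
  0 < lam -> 0 <= gam -> 0 <= mu -> 0 <= dist -> 0 < a ->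
  a%:E = strongly_convex_rate lam gam mu dist ->
  [/\ a <= 1 / 3, 6 * mu * a <= lam & gam * a ^+ 2 * dist <= 2 * lam].
Proof.
move=> lam0 gam0 mu0 dist0 a0 aE.
have : (a%:E <= strongly_convex_rate lam gam mu dist)%E by rewrite -aE.
rewrite /strongly_convex_rate !le_min lee_fin => /and3P[h1 h2 h3].
split; first by lra.
- have [->|mu_neq0] := eqVneq mu 0; first by rewrite mulr0 mul0r ltW.
  have m0 : 0 < 6 * mu by rewrite mulr_gt0// lt_neqAle eq_sym mu_neq0.
  move: h2; rewrite inver gt_eqF// -EFinM lee_fin ler_pdivlMr//.
  by rewrite mulrC.
- have [E|gd_neq0] := eqVneq (gam * dist) 0.
    by rewrite mulrAC E mul0r mulr_ge0 ?(ltW lam0).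
  have gd0 : 0 < gam * dist by rewrite lt_neqAle eq_sym gd_neq0 mulr_ge0.
  move: h3; rewrite inver gt_eqF// -EFinM /sqrte lee_fin.
  rewrite -(ler_sqr (ltW a0)) ?nnegrE ?sqrtr_ge0// sqr_sqrtr ?divr_ge0 ?mulr_ge0 ?(ltW lam0)//.
  by rewrite ler_pdivlMr// [_ * (gam * dist)]mulrC mulrAC.
Qed.

Lemma lipschitz_const_ge0 {R : realType} {n : nat} (f : 'cV[R]_n -> R) gam
    (x y : 'cV[R]_n) :
  hessian_lipschitz gam f -> x != y -> 0 <= gam.
Proof.
move=> lip xy; have := le_trans (spectral_norm_ge0 _) (lip x y).
by rewrite pmulr_lge0// enorm_gt0 subr_eq0.
Qed.

(** * The theorem *)

Theorem theorem4 (R : realType) (n : nat) (f : 'cV[R]_n -> R) (gamma : R)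
    (xstar : 'cV[R]_n) (x : nat -> 'cV[R]_n) (H : nat -> 'M[R]_n)
    (eta mu alpha : nat -> R) (mu_u : R)
    (f_C2 : twice_continuously_differentiable f)
    (f_lip : hessian_lipschitz gamma f)
    (xstar_min : minimizer f xstar)
    (x_INCR : INCR f H eta x)
    (H_psd : forall t, loewner_le 0 (H t))
    (H_approx : forall t, spectral_norm (hess f (x t) - H t) <= mu t)
    (mu_u_ge0 : 0 <= mu_u)
    (mu_bound : forall t, 0 <= mu t <= mu_u)
    (alpha_bound : forall t, 0 < alpha t <= 1)
    (eta_def : forall t, x t != xstar ->
       eta t = gamma + 2 * mu t / (alpha t * enorm (xstar - x t))) :
  (forall lambda : R, 0 < lambda -> strongly_convex lambda f ->
     (forall t, (alpha t)%:E =
        strongly_convex_rate lambda gamma (mu t) (enorm (x t - xstar))) ->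
     forall t, x t != xstar ->
       f (x t.+1) - f xstar <= (1 - alpha t) * (f (x t) - f xstar))
  /\
  (strongly_convex 0 f ->
     alpha 0%N = 1 -> (forall t, (1 <= t)%N -> 0 < alpha t < 1) ->
     forall t, (forall i, (i <= t)%N -> x i != xstar) ->
       f (x t.+1) - f xstar <=
         Aprod alpha t *
           (\sum_(i < t.+1)
               mu i * alpha i ^+ 2 * enorm (x i - xstar) ^+ 2 / Aprod alpha i
            + gamma * \sum_(i < t.+1)
               alpha i ^+ 3 * enorm (x i - xstar) ^+ 3 / (3 * Aprod alpha i))).
Proof.
have [fD gD _] := f_C2.
have mu0 t : 0 <= mu t by case/andP: (mu_bound t).
have alpha0 t : 0 < alpha t by case/andP: (alpha_bound t).
have Hsym t : (H t)^T = H t by case: (x_INCR t).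
have stepE t : x t + (x t.+1 - x t) = x t.+1 by rewrite subrKC.
have starE t : x t + (xstar - x t) = xstar by rewrite subrKC.
have step_min t : minimizer (cubic_model f (H t) (eta t) (x t)) (x t + (x t.+1 - x t)).
  by rewrite stepE; case: (x_INCR t).
have star_min t : minimizer f (x t + (xstar - x t)) by rewrite starE.
have e_neq0 t : x t != xstar -> xstar - x t != 0 by rewrite subr_eq0 eq_sym.
have distC t : enorm (xstar - x t) = enorm (x t - xstar) by rewrite -enormN opprB.
split=> [lam lam0 cvx rate t xt|cvx alpha0E alpha1 t xt].
  have gam0 := lipschitz_const_ge0 _ _ _ _ f_lip xt.
  have [a1 mua gama] := rate_bounds _ _ _ _ _ lam0 gam0 (mu0 t) (enorm_ge0 _) (alpha0 t) (rate t).
  have := strongly_convex_descent f gamma (x t) (x t.+1 - x t) (xstar - x t) (H t)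
    (eta t) (mu t) (alpha t) fD gD f_lip gam0 (star_min t) (e_neq0 t xt) (Hsym t)
    (H_approx t) (mu0 t) (alpha0 t) (eta_def t xt) (step_min t) lam lam0 cvx a1 mua.
  by rewrite stepE starE distC; apply.
have gam0 := lipschitz_const_ge0 _ _ _ _ f_lip (xt 0%N isT).
(* The error of step i; the summand of the bound is [c i / Aprod alpha i]. *)
pose c i := mu i * alpha i ^+ 2 * enorm (x i - xstar) ^+ 2
  + gamma * (alpha i ^+ 3 * enorm (x i - xstar) ^+ 3 / 3).
have step i : x i != xstar ->
    f (x i.+1) - f xstar <= (1 - alpha i) * (f (x i) - f xstar) + c i.
  move=> xi; have a1 : alpha i <= 1 by case/andP: (alpha_bound i).
  have := convex_descent f gamma (x i) (x i.+1 - x i) (xstar - x i) (H i)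
    (eta i) (mu i) (alpha i) fD gD f_lip (e_neq0 i xi)
    (H_approx i) (mu0 i) (alpha0 i) (eta_def i xi) (step_min i) cvx a1.
  by rewrite stepE starE distC.
have A0 i : 0 < Aprod alpha i.
  rewrite /Aprod big_nat; apply: prodr_gt0 => j /andP[j1 _].
  by rewrite subr_gt0; case/andP: (alpha1 j j1).
have AS i : Aprod alpha i.+1 = Aprod alpha i * (1 - alpha i.+1).
  by rewrite /Aprod big_nat_recr.
rewrite mulr_sumr -big_split /=.
under eq_bigr => i _.
  rewrite (_ : _ + _ = c i / Aprod alpha i); last by rewrite /c; field; rewrite lt0r_neq0.
  over.
elim: t xt => [|t IH] xt.
  rewrite big_ord1 mulrC divfK ?lt0r_neq0//.
  by have := step 0%N (xt 0%N isT); rewrite alpha0E subrr mul0r add0r.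
have {}IH := IH (fun i it => xt i (leqW it)).
apply: le_trans (step t.+1 (xt _ (leqnn _))) _.
rewrite big_ord_recr /= [leRHS]mulrDr [X in _ <= _ + X]mulrC divfK ?lt0r_neq0// lerD2r.
rewrite AS mulrAC mulrC ler_wpM2r//.
by rewrite subr_ge0; case/andP: (alpha_bound t.+1).
Qed.
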